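(* Let $n$ be a positive integer. There is an $n$-satisfactory coloring of $\mathbb Z^+$ in any of the following cases: (1) $n+1$ is prime. (2) $2n+1$ is prime. (3) More generally, there is a strong representative of order $n$, i.e., a prime $p$ of the form $nk+1$ for some positive integer $k$ such that $1^k,\dots,n^k$ are pairwise distinct modulo $p$. (4) Yet more generally, $n$ admits a partial $G$-isomorphism for some abelian group $(G,\oplus)$ of order $n$, i.e., there is a bijection $h:[n]\to G$ such that whenever $a,b\in[n]$ and $ab\in[n]$, then $h(ab)=h(a)\oplus h(b)$. In particular, there is an $n$-satisfactory coloring of $\mathbb Z^+$: (5) for all $n<195$, and (6) for all $n$ of the form $p^2-p$ for some prime $p$.
   Context: $[n]=\{1,2,\dots,n\}$. For a positive integer $n$, an $n$-satisfactory coloring of $\mathbb Z^+$ (the positive integers) is a coloring of $\mathbb Z^+$ using exactly $n$ colors such that for every positive integer $a$ the numbers $a,2a,\dots,na$ all receive different colors. *)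

(* Defs.v *)
From HB Require Import structures.
From mathcomp Require Import all_boot all_order all_algebra.

Set Implicit Arguments.
Unset Strict Implicit.
Unset Printing Implicit Defensive.

Import GRing.Theory.

Definition initial (n : nat) : pred nat := [pred a | 0 < a <= n].

(* A coloring of the positive integers is encoded as a function on nat; the
   value at 0 is junk and never constrained. The n colors are named by 'I_n,
   and the first conjunct says that each of them is used. *)
Definition satisfactory_coloring (n : nat) (c : nat -> 'I_n) : Prop :=
  (forall col : 'I_n, exists2 a : nat, 0 < a & c a = col) /\
  (forall a : nat, 0 < a ->
     {in initial n &, injective (fun i => c (i * a))}).

Definition has_satisfactory_coloring (n : nat) : Prop :=
  exists c : nat -> 'I_n, satisfactory_coloring c.

Definition strong_representative (n p : nat) : Prop :=
  prime p /\
  exists k : nat, [/\ 0 < k, p = n * k + 1 &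
    {in initial n &, forall i j, i ^ k = j ^ k %[mod p] -> i = j}].

Definition has_strong_representative (n : nat) : Prop :=
  exists p : nat, strong_representative n p.

(* h stands for a map on {1, ..., n}; its values elsewhere are junk. *)
Definition partial_isomorphism (n : nat) (G : finZmodType) (h : nat -> G) :
    Prop :=
  [/\ {in initial n &, injective h},
      forall g : G, exists2 a : nat, a \in initial n & h a = g &
      {in initial n &, forall a b,
         a * b \in initial n -> h (a * b) = (h a + h b)%R}].

Definition admits_partial_isomorphism (n : nat) : Prop :=
  exists G : finZmodType, #|G| = n /\
    exists h : nat -> G, partial_isomorphism n h.

(* Main.v *)
Require Import Defs.
From HB Require Import structures.
From mathcomp Require Import all_boot all_order all_algebra cyclic.

Set Implicit Arguments.
Unset Strict Implicit.
Unset Printing Implicit Defensive.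

Import GRing.Theory.

(** The multiples a, 2a, ..., na all receive different colors as soon as the
    color is a homomorphism from the multiplicative monoid of the positive
    integers to an abelian group of order n which is injective on [n]: the
    color of i * a is then the color of i translated by the color of a
    ([completely_additive_coloring]). A homomorphism on the positive integers
    is the same as an arbitrary choice of values at the primes, so a partial
    isomorphism extends to one: keep its values at the primes up to n, and send
    the larger primes to 0 ([partial_isomorphism_extends]).

    For the other cases it is enough to find a multiplicative map from [n] to
    the n-th roots of unity of a finite ring that has at most n of them:
    injectivity does the rest by counting
    ([partial_isomorphism_to_unity_roots]). For a strong representative
    p = nk + 1 the map is a |-> a^k in the field F_p, where Fermat's little
    theorem gives (a^k)^n = 1. The primes n + 1 and 2n + 1 are strong
    representatives with k = 1 and k = 2.

    For n = p^2 - p the target is the group of units of Z/p^2, which has order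
    n. The integers of [n] prime to p are sent to their own classes, and these
    miss precisely the units -1, ..., -(p - 1). The multiples of p in [n] are
    p, 2p, ..., (p - 1)p, and no product of two of them lies in [n], so
    up |-> -u fills the gap multiplicatively, as if p itself were sent to -1
    ([sqr_sub_prime_partial_isomorphism]).

    Below 195 there are 83 values of n such that n + 1 and 2n + 1 are composite
    and n is not of the form p^2 - p. For each of them some homomorphism to the
    cyclic group Z/n is injective on [n]; it is given by its values at the
    primes up to n, found by a backtracking search, and its injectivity on [n]
    is checked by computation
    ([prime_values_distinct]). *)

(** * From partial isomorphisms to colorings *)

Lemma in_initial_onto n (T : finType) (h : nat -> T) :
  #|T| = n -> {in initial n &, injective h} ->
  forall x, exists2 a, a \in initial n & h a = x.
Proof.
move=> cardT inj_h x.
pose f (i : 'I_n) := h i.+1.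
have inj_f : injective f.
  by move=> i j /inj_h; rewrite !inE !ltnS !ltn_ord => /(_ isT isT) [] /val_inj.
have le_card : #|T| <= #|'I_n| by rewrite cardT card_ord.
have /codomP[i ->] := inj_card_onto inj_f le_card x.
by exists i.+1; rewrite // inE ltn_ord.
Qed.

Definition completely_additive (V : zmodType) (h : nat -> V) :=
  forall a b, 0 < a -> 0 < b -> h (a * b) = (h a + h b)%R.

(** Multiplying 1, ..., n by a translates their colors by h a, and a
    translation is injective. *)
Lemma completely_additive_coloring n (G : finZmodType) (h : nat -> G) :
  #|G| = n -> completely_additive h -> {in initial n &, injective h} ->
  has_satisfactory_coloring n.
Proof.
move=> cardG hM inj_h; pose c a := cast_ord cardG (enum_rank (h a)).
have c_eq a b : c a = c b -> h a = h b by move/cast_ord_inj/enum_rank_inj.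
exists c; split=> [col | a a_gt0 i j i_n j_n].
  have [a a_n ha] :=
    in_initial_onto cardG inj_h (enum_val (cast_ord (esym cardG) col)).
  exists a; first by case/andP: a_n.
  by rewrite /c ha enum_valK cast_ordKV.
move/c_eq; rewrite !hM //; first last.
- by case/andP: i_n.
- by case/andP: j_n.
by move/addIr/inj_h; apply.
Qed.

(** This is the freedom to choose the value w i at each prime p i. *)
Lemma completely_additive_logn (V : zmodType) (I : Type) (r : seq I)
    (P : pred I) (p : I -> nat) (w : I -> V) :
  completely_additive (fun a => \sum_(i <- r | P i) w i *+ logn (p i) a)%R.
Proof.
move=> a b a_gt0 b_gt0; rewrite -big_split /=; apply: eq_bigr => i _.
by rewrite lognM // mulrnDr.
Qed.

(** Both maps send 1 to 0 and agree at the primes up to n, hence on [n] by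
    induction: splitting off the least prime factor of an element of [n] leaves
    a smaller element of [n]. *)
Lemma partial_isomorphism_extends n (G : finZmodType) (h : nat -> G) :
  {in initial n &, forall a b,
     a * b \in initial n -> h (a * b) = (h a + h b)%R} ->
  exists2 H : nat -> G, completely_additive H & {in initial n, H =1 h}.
Proof.
move=> hM; pose H a := (\sum_(p < n.+1 | prime p) h p *+ logn p a)%R.
have HM : completely_additive H by exact: completely_additive_logn.
have H_prime p : prime p -> p \in initial n -> H p = h p.
  move=> p_pr; rewrite inE => /andP[_ p_le_n]; rewrite /H.
  rewrite (bigD1 (Ordinal (p_le_n : p < n.+1))) //= logn_prime // eqxx mulr1n.
  rewrite big1 ?addr0 // => q /andP[q_pr]; rewrite -val_eqE /= => q_neq_p.
  by rewrite logn_prime // (negPf q_neq_p) mulr0n.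
have H1 : H 1 = 0%R by rewrite /H big1 // => p _; rewrite logn1 mulr0n.
exists H => //; move: H HM H_prime H1 => H HM H_prime H1 a; have [m] := ubnP a.
elim: m a => // m IHm a; rewrite ltnS => a_le_m a_n.
have [a_gt0 a_le_n] := andP a_n; have [a_le1|a_gt1] := leqP a 1.
  have -> : a = 1 by apply/eqP; rewrite eqn_leq a_le1.
  have n1 : 1 \in initial n by exact: leq_trans a_gt0 a_le_n.
  by apply: (addIr (h 1)); rewrite H1 add0r -hM.
have p_pr := pdiv_prime a_gt1; have p_dv := pdiv_dvd a.
set p := pdiv a in p_pr p_dv.
have p_n : p \in initial n.
  by rewrite inE prime_gt0 //= (leq_trans _ a_le_n) // dvdn_leq.
have b_gt0 : 0 < a %/ p by rewrite divn_gt0 ?prime_gt0 // dvdn_leq.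
have b_lt_a : a %/ p < a by rewrite ltn_Pdiv ?prime_gt1.
have b_n : a %/ p \in initial n by rewrite inE b_gt0 (leq_trans (ltnW b_lt_a)).
have IHb := IHm _ (leq_trans b_lt_a a_le_m) b_n.
have a_eq : a = p * (a %/ p) by rewrite mulnC divnK.
have := HM _ _ (prime_gt0 p_pr) b_gt0; have := hM _ _ p_n b_n.
by rewrite -a_eq => -> // ->; rewrite H_prime // IHb.
Qed.

Lemma partial_isomorphism_coloring n :
  admits_partial_isomorphism n -> has_satisfactory_coloring n.
Proof.
case=> G [cardG [h [inj_h _ hM]]].
have [H HM Hh] := partial_isomorphism_extends hM.
apply: (completely_additive_coloring cardG HM) => a b a_n b_n.
by rewrite !Hh //; exact: inj_h.
Qed.

(** * Partial isomorphisms to groups of roots of unity *)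

Section UnityRoots.
Local Open Scope ring_scope.
Variables (R : finComNzRingType) (m : nat).

(** The order is taken positive so that every root x has the inverse x ^+ m. *)
Definition unity_roots : predArgType := {x : R | x ^+ m.+1 == 1}.
HB.instance Definition _ := Finite.on unity_roots.
HB.instance Definition _ := SubType.on unity_roots.

Implicit Types x y : unity_roots.

Fact unity_roots_mul_subproof x y : (val x * val y) ^+ m.+1 == 1.
Proof. by rewrite exprMn (eqP (valP x)) (eqP (valP y)) mulr1. Qed.
Definition unity_roots_mul x y : unity_roots :=
  exist _ (val x * val y) (unity_roots_mul_subproof x y).

Fact unity_roots_one_subproof : (1 : R) ^+ m.+1 == 1.
Proof. by rewrite expr1n. Qed.
Definition unity_roots_one : unity_roots :=
  exist _ 1 unity_roots_one_subproof.

Fact unity_roots_inv_subproof x : (val x ^+ m) ^+ m.+1 == 1.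
Proof. by rewrite exprAC (eqP (valP x)) expr1n. Qed.
Definition unity_roots_inv x : unity_roots :=
  exist _ (val x ^+ m) (unity_roots_inv_subproof x).

Fact unity_roots_mulA : associative unity_roots_mul.
Proof. by move=> x y z; apply: val_inj; rewrite /= mulrA. Qed.
Fact unity_roots_mulC : commutative unity_roots_mul.
Proof. by move=> x y; apply: val_inj; rewrite /= mulrC. Qed.
Fact unity_roots_mul1 : left_id unity_roots_one unity_roots_mul.
Proof. by move=> x; apply: val_inj; rewrite /= mul1r. Qed.
Fact unity_roots_mulV :
  left_inverse unity_roots_one unity_roots_inv unity_roots_mul.
Proof.
by move=> x; apply: val_inj; rewrite /= -exprSr; apply/eqP/(valP x).
Qed.

(* Partial isomorphisms take values in additive groups, so the multiplication
   of roots of unity becomes the addition. *)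
HB.instance Definition _ := GRing.isZmodule.Build unity_roots
  unity_roots_mulA unity_roots_mulC unity_roots_mul1 unity_roots_mulV.

Lemma val_unity_rootsD x y : val (x + y) = val x * val y.
Proof. by []. Qed.

End UnityRoots.

(** The n distinct values of f exhaust the n-th roots of unity, as there are at
    most n of these. *)
Lemma partial_isomorphism_to_unity_roots n (R : finComNzRingType)
    (f : nat -> R) :
  0 < n -> #|[pred x : R | x ^+ n == 1]%R| <= n ->
  {in initial n, forall a, f a ^+ n = 1}%R ->
  {in initial n &, injective f} ->
  {in initial n &, forall a b,
     a * b \in initial n -> f (a * b) = (f a * f b)%R} ->
  admits_partial_isomorphism n.
Proof.
case: n => // m _ le_roots f_root inj_f fM.
pose h a : unity_roots R m := insubd (unity_roots_one R m) (f a).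
have val_h a : a \in initial m.+1 -> val (h a) = f a.
  by move/f_root/eqP => f_a; rewrite /h insubdK.
have inj_h : {in initial m.+1 &, injective h}.
  move=> a b a_n b_n /(congr1 val); rewrite !val_h //; exact: inj_f.
have card_roots : #|{: unity_roots R m}| = m.+1.
  apply/eqP; rewrite eqn_leq card_sig le_roots /= -{1}(card_ord m.+1).
  rewrite -(card_sig (fun x : R => x ^+ m.+1 == 1)%R).
  apply: (leq_card (fun i : 'I_m.+1 => h i.+1)) => i j /inj_h.
  by rewrite !inE !ltnS !leq_ord => /(_ isT isT) [] /val_inj.
exists (unity_roots R m); split => //; exists h; split => //.
  exact: in_initial_onto.
move=> a b a_n b_n ab_n; apply: val_inj.
by rewrite val_unity_rootsD !val_h // fM.
Qed.

(** * Strong representatives *)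

Lemma strong_representative_partial_isomorphism n :
  0 < n -> has_strong_representative n -> admits_partial_isomorphism n.
Proof.
move=> n_gt0 [p [p_pr [k [k_gt0 p_eq inj_pow]]]].
have p_gt1 := prime_gt1 p_pr.
have eq_Fp a b : (a%:R = b%:R :> 'F_p)%R -> a = b %[mod p].
  by move/(congr1 val); rewrite /= !val_Fp_nat.
pose f a : 'F_p := (a%:R ^+ k)%R.
apply: (@partial_isomorphism_to_unity_roots n _ f) => //.
- rewrite cardE max_unity_roots ?enum_uniq //.
  by apply/allP => x; rewrite mem_enum unity_rootE.
- move=> a; rewrite inE => /andP[a_gt0 a_le_n].
  have cop : coprime a p.
    rewrite coprime_sym prime_coprime // gtnNdvd // p_eq addn1 ltnS.
    by rewrite (leq_trans a_le_n) ?leq_pmulr.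
  (* The exponent k * n is p - 1, so this is Fermat's little theorem. *)
  rewrite -exprM mulnC -[n * k](addnK 1) -p_eq subn1 -totient_prime //.
  by rewrite -natrX -(Fp_nat_mod p_pr) Euler_exp_totient // Fp_nat_mod.
- by move=> a b a_n b_n; rewrite /f -!natrX => /eq_Fp; exact: inj_pow.
- by move=> a b _ _ _; rewrite /f natrM exprMn.
Qed.

Lemma prime_succ_strong_representative n :
  0 < n -> prime (n + 1) -> has_strong_representative n.
Proof.
move=> n_gt0 p_pr; exists (n + 1); split=> //.
exists 1; split; rewrite ?muln1 //.
move=> i j; rewrite !inE !expn1 addn1 => /andP[_ i_le] /andP[_ j_le].
by rewrite !modn_small.
Qed.

(** The prime 2n + 1 divides i^2 - j^2 = (i - j)(i + j), and i + j is between 1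
    and 2n. *)
Lemma prime_double_succ_strong_representative n :
  0 < n -> prime (2 * n + 1) -> has_strong_representative n.
Proof.
move=> n_gt0 p_pr; exists (2 * n + 1); split=> //; exists 2; split.
- by [].
- by rewrite mulnC.
move=> i j; rewrite !inE => /andP[i_gt0 i_le] /andP[j_gt0 j_le].
wlog ij : i j i_gt0 i_le j_gt0 j_le / j <= i => [hwlog | /eqP].
  have [|/ltnW] := leqP j i; first exact: hwlog.
  by move=> ij e; apply/esym; apply: hwlog.
rewrite eqn_mod_dvd ?leq_exp2r // subn_sqr Euclid_dvdM //.
case/orP => /dvdn_leq; last first.
  rewrite addn_gt0 i_gt0 => /(_ isT).
  by rewrite addn1 mul2n -addnn ltnNge leq_add.
rewrite subn_gt0; case: ltngtP ij => // ij _ /(_ isT).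
rewrite addn1 => le; suff : n < n by rewrite ltnn.
apply: leq_trans i_le; apply: leq_trans (leq_subr j i).
by apply: leq_trans le; rewrite ltnS leq_pmull.
Qed.

(** * The numbers p^2 - p *)

(** Injectivity amounts to a <> -u modulo p^2 when a is in [n] and u < p, which
    holds since a + u < n + p = p^2. *)
Lemma sqr_sub_prime_partial_isomorphism p :
  prime p -> admits_partial_isomorphism (p ^ 2 - p).
Proof.
move=> p_pr; set n := p ^ 2 - p; pose q := p ^ 2.
have p_gt1 := prime_gt1 p_pr; have p_gt0 := prime_gt0 p_pr.
have q_gt1 : 1 < q by rewrite (ltn_exp2l 0).
have n_tot : totient q = n.
  by rewrite totient_pfactor // /n expnS expn1 -subn1 mulnBl mul1n.
have le_pq : p <= q by rewrite /q expnS expn1 leq_pmulr.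
have n_q : n + p = q by rewrite subnK.
have n_gt0 : 0 < n by rewrite subn_gt0 (ltn_exp2l 1).
have cop_q a : coprime q a = ~~ (p %| a).
  by rewrite coprime_pexpl // prime_coprime.
have eq_Zq a b : (a%:R = b%:R :> 'Z_q)%R -> a = b %[mod q].
  by move/(congr1 val); rewrite /= !val_Zp_nat.
have unit_root (x : 'Z_q) : (x \is a GRing.unit -> x ^+ n = 1)%R.
  rewrite -[x]natr_Zp unitZpE // => cop; rewrite -natrX -n_tot.
  by rewrite -(Zp_nat_mod q_gt1) Euler_exp_totient 1?coprime_sym // Zp_nat_mod.
have small a : a \in initial n -> a < q.
  by rewrite inE -n_q => /andP[_ a_le]; rewrite -addn1 leq_add.
have quo a : a \in initial n -> p %| a -> 0 < a %/ p < p.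
  move=> a_n p_a; rewrite ltn_divLR // mulnn small // andbT.
  by rewrite divn_gt0 // dvdn_leq //; case/andP: a_n.
have quoN a : a \in initial n -> p %| a -> ~~ (p %| a %/ p).
  by move=> a_n p_a; have /andP[b_gt0 b_lt] := quo a a_n p_a; rewrite gtnNdvd.
pose f a : 'Z_q := if p %| a then (- (a %/ p)%N%:R)%R else a%:R%R.
apply: (@partial_isomorphism_to_unity_roots n _ f) => //.
- have card_unit : #|{: {unit 'Z_q}}| = n.
    by rewrite -n_tot -card_units_Zp ?cardsT // ltnW.
  rewrite -[X in _ <= X]card_unit -(card_image val_inj).
  apply/subset_leq_card/subsetP => x.
  rewrite inE => /eqP x_n.
  have x_unit : x \is a GRing.unit.
    by apply/unitrPr; exists (x ^+ n.-1)%R; rewrite -exprS prednK.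
  by apply/imageP; exists (FinRing.unit 'Z_q x_unit).
- move=> a a_n; apply: unit_root; rewrite /f; case: ifPn => p_a.
    by rewrite unitrN unitZpE // cop_q quoN.
  by rewrite unitZpE // cop_q.
- have mixed a b : a \in initial n -> b \in initial n -> p %| b ->
      (a%:R = - (b %/ p)%N%:R :> 'Z_q)%R -> False.
    move=> a_n b_n p_b /(congr1 (+%R^~ (b %/ p)%N%:R))%R.
    have /andP[c_gt0 c_lt] := quo b b_n p_b.
    rewrite addNr -natrD => /(eq_Zq _ 0); rewrite mod0n modn_small.
      by move/eqP; rewrite addn_eq0 => /andP[_]; apply/negP; rewrite -lt0n.
    rewrite -n_q -addnS leq_add //; by case/andP: a_n.
  move=> a b a_n b_n; rewrite /f.
  case: ifPn => p_a; case: ifPn => p_b.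
  + have /andP[_ a_lt] := quo a a_n p_a; have /andP[_ b_lt] := quo b b_n p_b.
    move/oppr_inj/eq_Zq; rewrite !modn_small ?(leq_trans _ le_pq) // => e.
    by rewrite -(divnK p_a) e divnK.
  + by move=> e; case: (mixed b a).
  + by move=> e; case: (mixed a b).
  + by move/eq_Zq; rewrite !modn_small ?small.
- move=> a b a_n b_n ab_n; rewrite /f Euclid_dvdM //.
  case: (boolP (p %| a)) => p_a; case: (boolP (p %| b)) => p_b /=.
  + have := small _ ab_n; rewrite ltnNge dvdn_leq ?dvdn_mul //.
    by case/andP: ab_n.
  + by rewrite -divn_mulAC // natrM mulNr.
  + by rewrite -muln_divA // natrM mulrN.
  + by rewrite natrM.
Qed.

(** * The numbers below 195 *)

Definition small_primes := [seq p <- iota 2 193 | prime p].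

Definition exponents a := [seq logn p a | p <- small_primes].

Definition dot (e v : seq nat) := sumn [seq x.1 * x.2 | x <- zip e v].

Lemma dot_exponentsM v a b :
  0 < a -> 0 < b ->
  dot (exponents (a * b)) v = dot (exponents a) v + dot (exponents b) v.
Proof.
move=> a_gt0 b_gt0; rewrite /dot /exponents.
elim: small_primes v => [|p ps IHps] [|x v] //=.
by rewrite IHps lognM // mulnDl addnACA.
Qed.

(** The exponents are shared between all n, so that the verification factors
    each integer only once. *)
Definition exponent_table := [seq exponents a | a <- iota 1 194].

Definition distinct_values n v :=
  uniq [seq dot e v %% n | e <- take n exponent_table].

Lemma distinct_values_coloring n v :
  0 < n <= 194 -> distinct_values n v -> has_satisfactory_coloring n.
Proof.
case: n => // m m_le; rewrite /distinct_values /exponent_table.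
rewrite -map_take take_iota (minn_idPl m_le) -map_comp => uniq_v.
pose H a : 'I_m.+1 := inZp (dot (exponents a) v).
apply: (@completely_additive_coloring m.+1 _ H); first exact: card_ord.
  move=> a b a_gt0 b_gt0; apply: val_inj.
  by rewrite /= dot_exponentsM // modnDm.
move=> [|a] [|b] // a_le b_le /(congr1 val) eq_ab; congr _.+1; apply/eqP.
rewrite -(nth_uniq 0 _ _ uniq_v) ?size_map ?size_iota //.
by rewrite !(nth_map 0) ?size_iota // !nth_iota // !add1n; apply/eqP.
Qed.

(** The row (n, v) describes the homomorphism to Z/n whose values at 2, 3, 5,
    7, 11, ... are listed by v. The search places the primes in increasing
    order; once q^2 > n, the n %/ q multiples of q in [n] have to fill a
    translate of the values already found on 1, ..., n %/ q. *)
Definition prime_values : seq (nat * seq nat) :=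
  [:: (7, [:: 1; 3; 5; 6]);
   (13, [:: 1; 10; 4; 6; 8; 9]);
   (17, [:: 1; 11; 14; 6; 9; 10; 16]);
   (19, [:: 1; 12; 15; 9; 7; 11; 17; 18]);
   (24, [:: 4; 3; 17; 19; 5; 2; 13; 14; 18]);
   (25, [:: 5; 3; 24; 14; 7; 1; 16; 21; 22]);
   (27, [:: 3; 8; 20; 2; 4; 15; 21; 22; 25]);
   (31, [:: 1; 25; 21; 5; 8; 17; 10; 12; 14; 24; 29]);
   (32, [:: 4; 3; 23; 21; 1; 13; 2; 18; 19; 22; 28]);
   (34, [:: 2; 23; 16; 22; 28; 13; 19; 3; 9; 31; 33]);
   (37, [:: 1; 29; 14; 33; 17; 11; 19; 8; 24; 26; 27; 36]);
   (38, [:: 2; 31; 18; 1; 23; 7; 12; 27; 15; 21; 30; 34]);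
   (43, [:: 1; 8; 33; 29; 6; 12; 21; 25; 15; 27; 28; 32; 39; 40]);
   (45, [:: 5; 3; 23; 14; 39; 27; 2; 35; 12; 21; 34; 36; 41; 43]);
   (47, [:: 1; 40; 28; 17; 6; 23; 12; 36; 38; 15; 20; 25; 27; 32; 44]);
   (49, [:: 7; 4; 23; 29; 6; 38; 17; 19; 41; 1; 2; 5; 16; 39; 47]);
   (55, [:: 5; 3; 27; 26; 40; 46; 19; 2; 39; 17; 21; 28; 38; 41; 47; 48]);
   (57, [:: 3; 16; 21; 49; 23; 4; 2; 31; 14; 33; 36; 43; 46; 50; 54; 56]);
   (59, [:: 1; 8; 39; 26; 43; 13; 30; 49; 32; 36; 7; 22; 46; 53; 54; 56; 58]);
   (61, [:: 1; 8; 20; 47; 37; 52; 26; 43; 13; 31; 7; 15; 19; 35; 42; 46; 58;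
      59]);
   (62, [:: 2; 14; 49; 25; 7; 33; 43; 46; 17; 24; 52; 13; 23; 34; 40; 58; 59;
      61]);
   (64, [:: 4; 3; 49; 33; 43; 27; 22; 59; 1; 17; 44; 23; 29; 32; 42; 50; 54;
      58]);
   (67, [:: 1; 32; 52; 25; 46; 59; 7; 13; 15; 20; 40; 9; 23; 42; 43; 51; 56;
      62; 63]);
   (71, [:: 1; 33; 19; 61; 11; 46; 16; 25; 69; 40; 42; 7; 15; 27; 32; 50; 55;
      57; 59; 60]);
   (73, [:: 1; 32; 19; 25; 29; 40; 11; 14; 17; 7; 54; 9; 37; 47; 56; 60; 63;
      68; 69; 70; 71]);
   (76, [:: 4; 13; 73; 49; 47; 59; 27; 28; 2; 33; 48; 54; 3; 11; 19; 42; 45;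
      65; 68; 69; 71]);
   (77, [:: 7; 3; 53; 58; 23; 43; 8; 48; 66; 5; 18; 38; 1; 40; 44; 47; 49; 52;
      54; 71; 75]);
   (79, [:: 1; 25; 17; 37; 31; 69; 11; 21; 64; 60; 72; 77; 9; 14; 24; 30; 41;
      45; 47; 49; 58; 66]);
   (80, [:: 10; 14; 37; 79; 2; 35; 11; 56; 73; 5; 33; 53; 6; 17; 18; 32; 41;
      62; 64; 68; 69; 75]);
   (84, [:: 12; 13; 9; 64; 74; 56; 29; 58; 7; 11; 28; 43; 47; 8; 10; 27; 32;
      63; 66; 67; 75; 78; 79]);
   (85, [:: 5; 3; 52; 74; 40; 34; 61; 73; 33; 26; 27; 49; 51; 17; 35; 47; 53;
      59; 68; 69; 70; 75; 81]);
   (87, [:: 3; 22; 24; 54; 17; 13; 61; 4; 40; 55; 2; 29; 56; 72; 8; 14; 45;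
      65; 73; 74; 80; 84; 86]);
   (91, [:: 7; 6; 41; 51; 80; 32; 9; 70; 37; 68; 22; 49; 52; 78; 4; 5; 17; 31;
      36; 66; 67; 79; 81; 90]);
   (92, [:: 4; 17; 59; 73; 10; 28; 74; 48; 53; 62; 3; 19; 35; 60; 11; 13; 37;
      47; 50; 58; 72; 86; 88; 89]);
   (93, [:: 3; 13; 28; 72; 67; 17; 8; 55; 71; 50; 79; 1; 24; 62; 38; 43; 48;
      49; 60; 64; 66; 86; 87; 90]);
   (94, [:: 2; 54; 87; 71; 53; 34; 79; 22; 61; 43; 84; 17; 23; 50; 67; 5; 29;
      32; 37; 41; 42; 74; 78; 92]);
   (97, [:: 1; 75; 63; 91; 33; 44; 50; 59; 13; 39; 48; 72; 81; 83; 86; 8; 18;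
      21; 24; 62; 68; 74; 89; 90; 95]);
   (101, [:: 1; 60; 93; 89; 39; 55; 16; 67; 23; 28; 71; 9; 32; 34; 36; 13; 45;
      46; 51; 66; 70; 73; 74; 75; 84; 98]);
   (103, [:: 1; 80; 72; 45; 86; 52; 93; 67; 31; 12; 16; 9; 19; 37; 65; 7; 25;
      39; 56; 61; 77; 78; 79; 98; 99; 100; 101]);
   (104, [:: 8; 3; 61; 95; 38; 68; 20; 39; 50; 70; 88; 5; 37; 57; 74; 1; 4;
      33; 51; 56; 63; 83; 87; 89; 90; 97; 102]);
   (107, [:: 1; 68; 47; 17; 37; 101; 81; 12; 22; 91; 99; 15; 26; 44; 56; 74;
      7; 28; 33; 36; 53; 61; 67; 78; 79; 88; 89; 93]);
   (109, [:: 1; 68; 59; 105; 89; 35; 74; 82; 98; 12; 25; 15; 21; 42; 44; 46;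
      8; 17; 40; 50; 51; 52; 53; 58; 67; 78; 79; 81; 88]);
   (115, [:: 5; 6; 29; 50; 42; 67; 3; 83; 81; 69; 97; 101; 33; 90; 99; 108; 1;
      4; 7; 19; 36; 37; 43; 51; 59; 80; 98; 109; 111; 114]);
   (117, [:: 9; 10; 53; 56; 32; 77; 5; 25; 90; 93; 12; 60; 8; 98; 101; 105; 3;
      6; 11; 31; 33; 49; 57; 61; 64; 67; 68; 79; 91; 113]);
   (118, [:: 2; 75; 66; 22; 37; 29; 1; 7; 92; 56; 63; 91; 15; 19; 50; 53; 108;
      42; 47; 57; 62; 71; 80; 86; 87; 102; 113; 115; 116; 117]);
   (121, [:: 11; 3; 50; 57; 106; 48; 23; 2; 27; 93; 29; 84; 8; 10; 65; 74; 78;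
      15; 41; 43; 69; 88; 92; 97; 99; 102; 108; 113; 116; 119]);
   (122, [:: 2; 88; 7; 21; 31; 66; 79; 103; 39; 51; 1; 82; 57; 65; 74; 78; 91;
      104; 19; 26; 36; 49; 50; 64; 77; 112; 114; 115; 117; 118]);
   (123, [:: 3; 32; 4; 110; 56; 89; 74; 49; 79; 69; 26; 34; 54; 17; 21; 28;
      87; 104; 2; 27; 33; 46; 48; 50; 94; 103; 105; 108; 115; 118]);
   (124, [:: 4; 27; 37; 88; 30; 32; 106; 90; 75; 6; 21; 46; 99; 7; 22; 51; 93;
      105; 15; 17; 23; 65; 77; 80; 87; 107; 111; 113; 116; 122]);
   (127, [:: 1; 68; 42; 54; 38; 20; 48; 118; 93; 15; 30; 35; 66; 13; 26; 99;
      104; 114; 19; 24; 28; 53; 61; 65; 75; 82; 87; 91; 101; 121; 125]);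
   (129, [:: 3; 17; 64; 103; 22; 79; 30; 7; 66; 104; 105; 45; 58; 97; 46; 92;
      116; 124; 19; 35; 52; 59; 60; 65; 74; 78; 91; 93; 102; 117; 118]);
   (132, [:: 12; 14; 114; 47; 131; 76; 39; 67; 127; 68; 105; 3; 89; 122; 33;
      57; 99; 121; 5; 16; 31; 34; 44; 55; 77; 97; 98; 107; 115; 116; 118;
      124]);
   (133, [:: 7; 9; 96; 88; 120; 56; 85; 123; 84; 24; 62; 45; 46; 80; 13; 57;
      108; 118; 2; 12; 15; 17; 29; 61; 67; 79; 81; 82; 100; 122; 128; 131]);
   (137, [:: 1; 79; 74; 43; 125; 91; 129; 114; 25; 106; 119; 54; 88; 97; 14;
      40; 49; 52; 109; 8; 10; 32; 36; 38; 58; 60; 70; 73; 103; 105; 111; 135;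
      136]);
   (139, [:: 1; 133; 32; 99; 49; 53; 117; 78; 74; 17; 89; 22; 30; 113; 39; 61;
      70; 104; 108; 8; 12; 15; 25; 42; 46; 57; 63; 67; 84; 92; 97; 116; 124;
      126]);
   (142, [:: 2; 59; 123; 105; 134; 60; 28; 112; 76; 15; 96; 18; 25; 128; 139;
      5; 47; 48; 52; 71; 1; 11; 33; 38; 58; 72; 79; 82; 91; 92; 95; 102; 103;
      132]);
   (143, [:: 11; 13; 86; 127; 32; 69; 14; 120; 49; 74; 126; 7; 94; 103; 134;
      30; 78; 79; 98; 106; 3; 9; 15; 31; 34; 72; 75; 76; 84; 88; 113; 124;
      128; 136]);
   (144, [:: 1; 17; 107; 99; 24; 119; 112; 76; 28; 88; 138; 15; 49; 56; 80;
      12; 59; 84; 91; 95; 8; 10; 23; 40; 44; 47; 61; 65; 69; 86; 98; 104; 106;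
      128]);
   (145, [:: 5; 12; 57; 139; 70; 96; 95; 66; 42; 131; 28; 53; 97; 116; 117;
      45; 68; 98; 125; 137; 1; 2; 3; 19; 31; 49; 55; 88; 91; 104; 115; 118;
      134; 135]);
   (147, [:: 7; 12; 32; 67; 103; 73; 137; 107; 70; 118; 1; 18; 54; 116; 131;
      10; 34; 55; 83; 101; 145; 6; 16; 20; 37; 69; 72; 75; 100; 104; 109; 120;
      133; 136]);
   (149, [:: 1; 47; 22; 111; 15; 122; 99; 81; 58; 32; 40; 138; 28; 85; 89; 12;
      76; 92; 107; 118; 130; 8; 19; 27; 35; 53; 55; 65; 68; 78; 88; 104; 110;
      127; 148]);
   (151, [:: 1; 60; 67; 23; 51; 139; 15; 103; 33; 78; 57; 86; 21; 41; 131; 8;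
      72; 97; 109; 114; 147; 10; 14; 28; 32; 45; 66; 77; 95; 99; 107; 116;
      125; 133; 137; 149]);
   (152, [:: 8; 3; 55; 143; 85; 117; 81; 95; 57; 67; 26; 99; 33; 44; 124; 31;
      37; 51; 130; 131; 145; 4; 21; 53; 77; 78; 80; 90; 94; 100; 114; 116;
      129; 135; 144; 147]);
   (154, [:: 11; 3; 65; 131; 85; 129; 24; 15; 56; 94; 81; 136; 72; 112; 114;
      23; 32; 52; 93; 102; 127; 13; 19; 49; 54; 61; 69; 86; 95; 100; 120; 122;
      124; 126; 128; 149]);
   (157, [:: 1; 87; 127; 149; 93; 45; 52; 38; 112; 146; 154; 31; 13; 35; 50;
      11; 65; 72; 77; 101; 107; 26; 56; 61; 68; 70; 75; 83; 103; 109; 111;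
      115; 117; 123; 135; 136; 143]);
   (159, [:: 3; 102; 40; 112; 64; 32; 116; 91; 135; 123; 133; 30; 47; 79; 84;
      110; 39; 60; 71; 89; 98; 103; 5; 11; 19; 24; 25; 29; 31; 56; 93; 99;
      127; 130; 143; 146; 154]);
   (160, [:: 10; 12; 78; 65; 29; 109; 1; 71; 115; 35; 72; 134; 5; 57; 147;
      152; 9; 28; 63; 76; 96; 116; 7; 26; 43; 68; 80; 103; 111; 122; 123; 124;
      132; 145; 148; 151; 158]);
   (161, [:: 1; 127; 116; 88; 67; 147; 109; 10; 17; 27; 30; 99; 80; 86; 140;
      158; 39; 50; 57; 62; 77; 107; 8; 24; 42; 47; 66; 104; 122; 123; 125;
      135; 136; 139; 151; 152; 153]);
   (163, [:: 1; 16; 58; 144; 97; 92; 120; 27; 70; 22; 157; 66; 53; 88; 111;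
      138; 45; 56; 83; 102; 130; 134; 9; 12; 25; 37; 42; 47; 81; 96; 105; 107;
      119; 140; 142; 143; 149; 153]);
   (164, [:: 4; 69; 29; 11; 148; 129; 82; 96; 10; 46; 70; 59; 126; 2; 32; 120;
      60; 114; 117; 119; 143; 157; 9; 30; 35; 52; 55; 65; 68; 76; 92; 95; 97;
      105; 135; 136; 144; 145]);
   (167, [:: 1; 106; 35; 92; 41; 24; 54; 162; 83; 119; 124; 11; 50; 114; 135;
      139; 20; 28; 61; 67; 97; 103; 112; 14; 16; 34; 64; 73; 75; 79; 88; 100;
      122; 145; 150; 155; 157; 158; 166]);
   (169, [:: 13; 5; 162; 97; 61; 125; 50; 93; 152; 108; 124; 22; 51; 29; 83;
      99; 69; 72; 114; 126; 133; 140; 163; 14; 40; 46; 47; 73; 75; 84; 94;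
      105; 109; 142; 144; 154; 159; 161; 166]);
   (170, [:: 10; 54; 66; 77; 135; 83; 3; 92; 24; 55; 61; 114; 167; 8; 35; 37;
      1; 22; 43; 49; 72; 95; 119; 5; 6; 9; 36; 63; 68; 98; 99; 110; 123; 125;
      126; 133; 136; 139; 144]);
   (171, [:: 19; 5; 92; 25; 21; 137; 74; 115; 85; 56; 145; 22; 119; 28; 141;
      169; 52; 70; 72; 108; 144; 151; 159; 2; 8; 11; 73; 80; 83; 88; 96; 106;
      126; 128; 129; 143; 152; 165; 167]);
   (175, [:: 1; 125; 46; 166; 62; 145; 152; 110; 140; 34; 68; 19; 72; 132; 40;
      105; 8; 28; 30; 56; 84; 86; 88; 15; 33; 44; 59; 81; 98; 99; 100; 104;
      120; 123; 135; 139; 149; 161; 163; 164]);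
   (177, [:: 3; 27; 116; 38; 155; 53; 136; 96; 138; 37; 46; 45; 124; 129; 7;
      110; 175; 14; 23; 98; 109; 114; 115; 2; 22; 24; 28; 29; 69; 70; 88; 89;
      90; 100; 104; 120; 140; 147; 148; 159]);
   (181, [:: 1; 26; 150; 16; 70; 90; 107; 112; 8; 130; 12; 49; 100; 147; 36;
      63; 143; 66; 82; 84; 94; 124; 136; 170; 15; 25; 41; 46; 48; 57; 61; 103;
      111; 127; 129; 141; 161; 163; 165; 172; 174; 175]);
   (182, [:: 1; 95; 146; 113; 83; 124; 68; 49; 159; 129; 118; 63; 133; 167;
      106; 108; 140; 34; 101; 136; 152; 170; 173; 175; 18; 20; 22; 30; 36; 40;
      54; 58; 75; 81; 92; 94; 128; 138; 143; 157; 165; 177]);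
   (184, [:: 4; 21; 69; 91; 145; 32; 110; 6; 1; 150; 72; 39; 79; 113; 104;
      126; 144; 151; 7; 55; 62; 78; 136; 139; 15; 38; 49; 65; 68; 86; 96; 109;
      128; 129; 156; 162; 167; 169; 173; 176; 178; 180]);
   (185, [:: 5; 40; 7; 139; 36; 107; 84; 121; 64; 171; 63; 108; 101; 132; 37;
      105; 158; 168; 3; 6; 28; 44; 53; 135; 67; 78; 82; 88; 102; 123; 134;
      138; 150; 155; 162; 167; 169; 170; 174; 177; 182; 183]);
   (187, [:: 1; 116; 137; 27; 131; 178; 150; 38; 103; 84; 147; 20; 56; 123;
      11; 70; 95; 173; 25; 42; 50; 63; 98; 112; 9; 15; 23; 35; 44; 59; 74; 78;
      92; 110; 115; 126; 156; 160; 167; 168; 171; 185]);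
   (188, [:: 4; 25; 7; 137; 131; 48; 121; 168; 85; 87; 101; 99; 63; 115; 157;
      6; 13; 47; 42; 49; 118; 154; 155; 173; 2; 26; 35; 68; 69; 76; 78; 102;
      113; 120; 127; 134; 136; 167; 178; 183; 184; 186]);
   (193, [:: 1; 107; 186; 156; 26; 122; 55; 96; 173; 139; 153; 168; 60; 64;
      77; 31; 40; 45; 8; 12; 34; 74; 83; 104; 17; 39; 44; 50; 69; 80; 92; 95;
      106; 114; 118; 127; 131; 137; 144; 145; 164; 165; 185; 192])].

Lemma prime_values_distinct :
  all (fun row => distinct_values row.1 row.2) prime_values.
Proof. by vm_compute. Qed.

Lemma below_195_cases n : 0 < n < 195 ->
  [|| prime (n + 1), prime (2 * n + 1),
      n \in [seq p ^ 2 - p | p <- [:: 7; 11; 13]]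
    | n \in unzip1 prime_values].
Proof.
move=> n_lt; have : n \in iota 1 194 by rewrite mem_iota.
by move: n {n_lt}; apply/allP; vm_compute.
Qed.

Lemma below_195_coloring n : 0 < n < 195 -> has_satisfactory_coloring n.
Proof.
move=> n_lt; have n_gt0 : 0 < n by case/andP: n_lt.
case/or4P: (below_195_cases n_lt).
- move/(prime_succ_strong_representative n_gt0).
  move/(strong_representative_partial_isomorphism n_gt0).
  exact: partial_isomorphism_coloring.
- move/(prime_double_succ_strong_representative n_gt0).
  move/(strong_representative_partial_isomorphism n_gt0).
  exact: partial_isomorphism_coloring.
- case/mapP=> p p_in ->; apply: partial_isomorphism_coloring.
  apply: sqr_sub_prime_partial_isomorphism.
  by apply: (allP _ p p_in).
- case/mapP=> -[m v] /(allP prime_values_distinct) v_ok /= n_eq.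
  by subst m; apply: distinct_values_coloring v_ok.
Qed.

Theorem theorem1p6 (n : nat) (n_gt0 : 0 < n) :
  [/\ prime (n + 1) -> has_satisfactory_coloring n,
      prime (2 * n + 1) -> has_satisfactory_coloring n,
      has_strong_representative n -> has_satisfactory_coloring n &
      admits_partial_isomorphism n -> has_satisfactory_coloring n] /\
  (n < 195 -> has_satisfactory_coloring n) /\
  ((exists2 p : nat, prime p & n = p ^ 2 - p) ->
     has_satisfactory_coloring n) /\
  (* "more generally", "yet more generally" *)
  [/\ prime (n + 1) -> has_strong_representative n,
      prime (2 * n + 1) -> has_strong_representative n &
      has_strong_representative n -> admits_partial_isomorphism n].
Proof.
have strong1 := prime_succ_strong_representative n_gt0.
have strong2 := prime_double_succ_strong_representative n_gt0.
have iso3 := strong_representative_partial_isomorphism n_gt0.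
have color4 := @partial_isomorphism_coloring n.
split; first by split; auto.
split; first by move=> n_lt; apply: below_195_coloring; rewrite n_gt0.
split=> [[p p_pr n_eq] | //].
by apply: color4; rewrite n_eq; apply: sqr_sub_prime_partial_isomorphism.
Qed.
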